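(* Let $q$ be odd and let $u,v,w\in\mathbb F_q[x]$ be monic quadratics such that $f=uvw$ is square-free of degree six and $\mathfrak d(u,v,w)=0$. Let $C:y^2=f(x)$, let $R=\operatorname{Res}(u,v)$, let $(M_2,M_1,M_0)$ be the minors of $(u,v)$, and let $c\in\overline{\mathbb F}_q$ satisfy $c^2=R^3$. Then $$\tau:(x,y)\longmapsto\Bigl(\iota(x),\ \frac{c\,y}{(M_2x+M_1)^3}\Bigr),\qquad \iota(x)=\frac{-M_1x-M_0}{M_2x+M_1},$$ is an automorphism of $C$ with $\tau^2=\mathrm{id}$, and $\tau$ is not the hyperelliptic involution. Consequently the reduced automorphism group of $C$ contains $\langle\iota\rangle\cong C_2$. Moreover: (i) $\tau$ is defined over $\mathbb F_q$ if and only if the splitting class is a square; otherwise it is defined over $\mathbb F_{q^2}$. (ii) $\iota$ is an affine map of the $x$-line, equivalently fixes the point at infinity, if and only if $M_2=0$ for one and hence for all three pairs among $(u,v),(v,w),(w,u)$, equivalently $u_1=v_1=w_1$, that is, exactly when the triple $(u,v,w)$ has nontrivial stabiliser in $\operatorname{Aff}(\mathbb F_q)$.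
   Context: For $s=x^2+s_1x+s_0$ etc., $\mathfrak d(u,v,w)$ is the determinant of the matrix with rows $(u_0,u_1,1),(v_0,v_1,1),(w_0,w_1,1)$. The minors of a pair $(a,b)$ of monic quadratics are $M_2=b_1-a_1$, $M_1=b_0-a_0$, $M_0=a_1b_0-a_0b_1$. $C$ denotes the smooth projective genus-2 curve. The splitting class is the class of $\operatorname{Res}(u,v)$ in $\mathbb F_q^\times/(\mathbb F_q^\times)^2$, the same for all three pairs. The reduced automorphism group of $C$ is $\operatorname{Aut}(C_{\overline{\mathbb F}_q})$ modulo the hyperelliptic involution, viewed as acting on the $x$-line $\mathbb P^1$. $\operatorname{Aff}(\mathbb F_q)$ is the group of maps $x\mapsto ax+b$ ($a\in\mathbb F_q^\times$, $b\in\mathbb F_q$), acting on monic quadratics by $s\mapsto a^{-2}s(ax+b)$ and componentwise on triples. *)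

(* Defs.v *)
From HB Require Import structures.
From mathcomp Require Import all_boot all_order all_algebra all_field.
From mathcomp Require Import mpoly.
Set Implicit Arguments.
Unset Strict Implicit.
Unset Printing Implicit Defensive.
Import GRing.Theory.
Local Open Scope ring_scope.

Section Quadratics.
Variable F : finFieldType.
Implicit Types (a b s u v w : {poly F}) (x : F).

Definition monic_quadratic s := (s \is monic) && (size s == 3%N).

Definition frakd u v w : F :=
  \det (\matrix_(i < 3, j < 3)
          let s := tnth [tuple u; v; w] i in tnth [tuple s`_0; s`_1; 1] j).

Definition minor2 a b := b`_1 - a`_1.
Definition minor1 a b := b`_0 - a`_0.
Definition minor0 a b := a`_1 * b`_0 - a`_0 * b`_1.

(* The class of x in F^* / (F^* )^2, as a coset. *)
Definition square_class x : {set F} :=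
  [set x * r ^+ 2 | r : F & r != 0].
Definition splitting_class u v := square_class (resultant u v).

(* The affine map x |-> g.1 * x + g.2, g.1 != 0, acting on monic quadratics. *)
Definition aff_act (g : F * F) s : {poly F} :=
  g.1 ^- 2 *: (s \Po (g.1 *: 'X + g.2%:P)).

Definition aff_stab u v w : {set F * F} :=
  [set g | [&& g.1 != 0, aff_act g u == u, aff_act g v == v & aff_act g w == w]].

End Quadratics.

Definition square_free (F : fieldType) (f : {poly F}) :=
  forall g : {poly F}, size g != 1%N -> ~~ (g ^+ 2 %| f).

(* None is the point at infinity. *)
Definition P1 (K : fieldType) := option K.

(* The point [X : Z] of the projective line, for (X, Z) != (0, 0). *)
Definition P1_of (K : fieldType) (X Z : K) : P1 K :=
  if Z == 0 then None else Some (X / Z).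

(* [X : Z] |-> [a X + b Z : c X + d Z]; meaningful when a d - b c != 0. *)
Definition mobius (K : fieldType) (a b c d : K) (p : P1 K) : P1 K :=
  if p is Some x then P1_of (a * x + b) (c * x + d) else P1_of a c.

Definition affine_map (K : fieldType) (g : P1 K -> P1 K) :=
  exists a b : K, a != 0 /\ g =1 omap (fun x => a * x + b).

(* g' is an integral power of the bijection g. *)
Definition in_cycle (T : Type) (g g' : T -> T) :=
  exists n : nat,
    g' =1 iter n g \/ cancel (iter n g) g' /\ cancel g' (iter n g).

(* The group generated by the bijection g is isomorphic to C_2. *)
Definition cycle_isog_C2 (T : Type) (g : T -> T) :=
  exists theta : 'Z_2 -> T -> T,
    [/\ forall i j, theta (i + j) =1 theta i \o theta j,
        forall i j, theta i =1 theta j -> i = j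
      & forall g', in_cycle g g' <-> exists i, g' =1 theta i].

(* The weights of X, Y, Z in the weighted projective plane P(1, 3, 1). *)
Definition wdeg (m : 'X_{1..3}) : nat :=
  (\sum_(i < 3) m i * tnth [tuple 1; 3; 1] i)%N.

Lemma wdeg0 : wdeg 0%MM = 0%N.
Proof. by rewrite /wdeg big1 // => i _; rewrite mnm0E. Qed.

Lemma wdegD : {morph wdeg : m1 m2 / (m1 + m2)%MM >-> (m1 + m2)%N}.
Proof.
move=> m1 m2; rewrite /wdeg -big_split /=.
by apply: eq_bigr => i _; rewrite mnmDE mulnDl.
Qed.

HB.instance Definition _ := isMeasure.Build 3 wdeg wdeg0 wdegD.

Section Curve.
Variable K : fieldType.

(* The points of P(1, 3, 1) other than the vertex [0 : 1 : 0], which lies on   *)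
(* no curve Y^2 = F(X, Z) below: each has a unique representative with Z = 1   *)
(* or (X, Z) = (1, 0), hence is given by its x-line coordinate and by Y.       *)
Definition wpoint := (P1 K * K)%type.

Definition hcoord (P : wpoint) : 3.-tuple K :=
  if P.1 is Some x then [tuple x; P.2; 1] else [tuple 1; P.2; 0].

(* a, b, d are homogeneous coordinates of P. *)
Definition represents (a b d : K) (P : wpoint) :=
  exists2 l : K, l != 0 &
    [/\ a = l * tnth (hcoord P) 0, b = l ^+ 3 * tnth (hcoord P) 1
      & d = l * tnth (hcoord P) 2].

Variable f : {poly K}.

Definition on_curve (P : wpoint) : bool :=
  let X := tnth (hcoord P) 0 in
  let Y := tnth (hcoord P) 1 in
  let Z := tnth (hcoord P) 2 in
  Y ^+ 2 == \sum_(i < 7) f`_i * X ^+ i * Z ^+ (6 - i)%N.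

(* For f square-free of degree 6 and K algebraically closed of characteristic  *)
(* not 2, the K-points of the smooth projective model, of genus 2, of the      *)
(* affine curve y^2 = f(x): the curve Y^2 = F(X, Z) in P(1, 3, 1), F being the *)
(* homogenisation of f.                                                        *)
Definition curve := {P : wpoint | on_curve P}.

Definition xline (P : curve) : P1 K := (val P).1.

Definition at_pt (A : {mpoly K[3]}) (P : curve) : K := A.@[tnth (hcoord (val P))].

Definition nonvanishing (A B D : {mpoly K[3]}) (P : curve) :=
  [|| at_pt A P != 0, at_pt B P != 0 | at_pt D P != 0].

(* alpha is a morphism defined over the subfield k: near each point it is      *)
(* [A : B : D] for weighted-homogeneous polynomials A, B, D over k.            *)
(* Restricting to a smaller neighbourhood h != 0 amounts to replacing          *)
(* (A, B, D) by (h A, h^3 B, h D).                                             *)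
Definition morphism_over (k : {pred K}) (alpha : curve -> curve) :=
  forall P, exists (d : nat) (A B D : {mpoly K[3]}),
    [/\ [/\ A \is a mpolyOver 3 k, B \is a mpolyOver 3 k & D \is a mpolyOver 3 k],
        [/\ A \is [in K[3], d.-homog for wdeg],
            B \is [in K[3], (3 * d).-homog for wdeg]
          & D \is [in K[3], d.-homog for wdeg]],
        nonvanishing A B D P
      & forall Q, nonvanishing A B D Q ->
          represents (at_pt A Q) (at_pt B Q) (at_pt D Q) (val (alpha Q))].

Definition automorphism (alpha : curve -> curve) :=
  morphism_over predT alpha /\
  exists beta : curve -> curve,
    [/\ morphism_over predT beta, cancel alpha beta & cancel beta alpha].

Lemma hyperelliptic_subproof (P : curve) : on_curve ((val P).1, - (val P).2).
Proof.
by case: P => -[[x|] y] /= => [|]; rewrite /on_curve /hcoord /= => /eqP <-;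
  rewrite !(tnth_nth 0) /= sqrrN.
Qed.

Definition hyperelliptic (P : curve) : curve := Sub _ (hyperelliptic_subproof P).

(* The class of alpha modulo the group generated by the hyperelliptic          *)
(* involution.                                                                 *)
Definition hcoset (alpha : curve -> curve) : (curve -> curve) -> Prop :=
  fun beta => beta =1 alpha \/ beta =1 hyperelliptic \o alpha.

(* g is the permutation of the x-line by which some element of the reduced     *)
(* automorphism group acts.                                                    *)
Definition in_reduced_aut (g : P1 K -> P1 K) :=
  exists alpha, automorphism alpha /\
    forall beta, hcoset alpha beta -> forall P, xline (beta P) = g (xline P).

End Curve.

(* Main.v *)
Require Import Defs.
From mathcomp Require Import all_boot all_order all_algebra all_field.
From mathcomp Require Import abelian mpoly ring.
Set Implicit Arguments.
Unset Strict Implicit.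
Unset Printing Implicit Defensive.
Import GRing.Theory.
Local Open Scope ring_scope.

(** The vanishing of the determinant says that [w] lies on the pencil spanned
    by [u] and [v].  The roots of the members of a pencil of binary quadratic
    forms without common zero are the pairs exchanged by one involution of the
    projective line, here [iota], with matrix (-M1, -M0; M2, M1) of
    determinant -R, where R = M1^2 - M2 M0 is the resultant of [u] and [v].
    Substituting this matrix into the homogenisation of any member multiplies
    it by R [pencil_involution]; hence it multiplies the sextic form F
    homogenising u v w by R^3 [hform_pencil].  As c^2 = R^3, the linear map
    [X : Y : Z] |-> [-M1 X - M0 Z : c Y : M2 X + M1 Z] of P(1, 3, 1) preserves
    the curve Y^2 = F(X, Z); this is [tau].  Its square is given by
    (R X, R^3 Y, R Z), that is, it is the identity.  Treating [tau] as a single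
    linear map makes the points at infinity and the poles of [iota] ordinary:
    one triple of forms represents [tau] everywhere, and a point is determined
    by any of its homogeneous coordinates [wpoint_of_represents].

    Since K is algebraically closed, every point of the x-line lifts to the
    curve [xline_surj], so that identities and non-identities pass between
    [tau] and [iota]: [iota] is an involution because [tau] is, and [tau] is
    not the hyperelliptic involution because [iota] is not the identity.

    Field of definition: the coefficients of [tau] other than c come from F.
    If R is a square r^2 in F then c = r^3 or c = - r^3 is in F, and in any
    case c^2 in F gives c^q = c or c^q = - c, so that c is in the field of q^2
    elements.  Conversely, a morphism over F commutes with the q-power
    Frobenius map on points [morphism_over_frob]; comparing the Y-coordinates
    of the images of one general point gives c^q = c, so c is in F, and
    R = (c / R)^2 is a square.

    Affineness: [iota] fixes infinity iff M2 = 0, i.e. u_1 = v_1.  As u and v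
    are distinct, collinearity of the three coefficient vectors then forces
    w_1 to agree with them [collinear_minor2].  An affine map x |-> a x + b
    other than the identity fixing s must have 2 b = (a - 1) s_1 with a != 1,
    which determines s_1; conversely x |-> - x - s_1 fixes s. *)

(** * Linear maps of the weighted projective plane P(1, 3, 1) *)

Section Weighted.
Variable K : fieldType.
Implicit Types (a b c d e x y z : K) (P : wpoint K) (f : {poly K}).

Notation hX P := (tnth (hcoord P) 0).
Notation hY P := (tnth (hcoord P) 1).
Notation hZ P := (tnth (hcoord P) 2).

(** The normal form of [a : b : d] in P(1, 3, 1): one divides by [d], and by
    [a] at infinity, with weight 3 on the middle coordinate. *)
Definition wpoint_of a b d : wpoint K :=
  (P1_of a d, b / (if d == 0 then a else d) ^+ 3).

Lemma represents_wpoint_of a b d :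
  (a != 0) || (d != 0) -> represents a b d (wpoint_of a b d).
Proof.
rewrite /wpoint_of /P1_of /represents /hcoord /=.
have [->|d0] := eqVneq d 0 => h /=.
  have a0 : a != 0 by case/orP: h.
  exists a => //.
  by split; rewrite !(tnth_nth 0) /= ?mulr1 ?mulr0 // mulrCA divff ?mulr1 ?expf_neq0.
exists d => //.
by split; rewrite !(tnth_nth 0) /= ?mulr1 // mulrCA divff ?mulr1 ?expf_neq0.
Qed.

Lemma wpoint_of_represents a b d P : represents a b d P -> P = wpoint_of a b d.
Proof.
case: P => -[x|] y [l l0 []]; rewrite /wpoint_of /P1_of /hcoord !(tnth_nth 0) /=.
  rewrite mulr1 => -> -> ->; rewrite (negPf l0).
  by congr (Some _, _); field.
rewrite mulr0 mulr1 => -> -> ->; rewrite eqxx.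
by congr (None, _); field.
Qed.

Lemma hcoord_neq0 P : (hX P != 0) || (hZ P != 0).
Proof. by case: P => -[x|] y; rewrite !(tnth_nth 0) /= oner_eq0 ?orbT. Qed.

Lemma represents_hcoord P : represents (hX P) (hY P) (hZ P) P.
Proof. by exists 1; rewrite ?oner_eq0 // expr1n !mul1r. Qed.

(** The binary sextic form homogenising [f], when the degree is at most 6. *)
Definition hform f x z := \sum_(i < 7) f`_i * x ^+ i * z ^+ (6 - i)%N.

(** Both sides of the equation of the curve have weight 6, so that it can be
    tested on arbitrary homogeneous coordinates. *)
Lemma on_curve_represents f a b d P :
  represents a b d P -> on_curve f P = (b ^+ 2 == hform f a d).
Proof.
case=> l l0 [-> -> ->]; rewrite /on_curve -/(hform f _ _).
have -> : hform f (l * hX P) (l * hZ P) = l ^+ 6 * hform f (hX P) (hZ P).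
  rewrite /hform mulr_sumr; apply: eq_bigr => i _.
  have -> : l ^+ 6 = l ^+ i * l ^+ (6 - i) by rewrite -exprD subnKC // -ltnS.
  by rewrite !exprMn; ring.
by rewrite exprMn -exprM (inj_eq (mulfI _)) // expf_neq0.
Qed.

Section LinearMap.
Variables a b c d e : K.

Definition wlin P : wpoint K :=
  wpoint_of (a * hX P + b * hZ P) (e * hY P) (c * hX P + d * hZ P).

Hypothesis det0 : a * d - b * c != 0.

Lemma lin_neq0 x z : (x != 0) || (z != 0) ->
  (a * x + b * z != 0) || (c * x + d * z != 0).
Proof.
rewrite -!negb_and; apply: contra => /andP[/eqP h1 /eqP h2].
have /eqP : (a * d - b * c) * x = 0.
  by transitivity (d * (a * x + b * z) - b * (c * x + d * z));
    [ring | rewrite h1 h2 !mulr0 subrr].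
have /eqP : (a * d - b * c) * z = 0.
  by transitivity (a * (c * x + d * z) - c * (a * x + b * z));
    [ring | rewrite h1 h2 !mulr0 subrr].
by rewrite !mulf_eq0 (negPf det0) /= => -> ->.
Qed.

Lemma represents_wlin x y z P : represents x y z P ->
  represents (a * x + b * z) (e * y) (c * x + d * z) (wlin P).
Proof.
case=> l l0 [-> -> ->].
have [m m0 [h1 h2 h3]] := represents_wpoint_of (e * hY P) (lin_neq0 (hcoord_neq0 P)).
exists (l * m); first by rewrite mulf_neq0.
split.
- by rewrite -[RHS]mulrA -h1; ring.
- by rewrite exprMn -[RHS]mulrA -h2; ring.
- by rewrite -[RHS]mulrA -h3; ring.
Qed.

Lemma wlin_on_curve f :
  (forall x z, hform f (a * x + b * z) (c * x + d * z) = e ^+ 2 * hform f x z) ->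
  forall P, on_curve f P -> on_curve f (wlin P).
Proof.
move=> fE P; rewrite (on_curve_represents _ (represents_hcoord P)).
rewrite (on_curve_represents _ (represents_wlin (represents_hcoord P))).
by move=> /eqP h; rewrite fE exprMn h.
Qed.

(** No covering by charts is needed: the three forms have no common zero, so
    that one triple represents the map at all points. *)
Lemma wlin_morphism_over f (k : {pred K}) (alpha : curve f -> curve f) :
  0 \in k -> [/\ a \in k, b \in k, c \in k, d \in k & e \in k] ->
  (forall Q, val (alpha Q) = wlin (val Q)) -> morphism_over k alpha.
Proof.
move=> k0 [ka kb kc kd ke] alphaE Q0.
pose lin s t : {mpoly K[3]} := s *: 'X_0 + t *: 'X_2.
have linE s t (Q : curve f) : at_pt (lin s t) Q = s * hX (val Q) + t * hZ (val Q).
  by rewrite /at_pt mevalD !mevalZ !mevalXU.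
have lin_over s t : s \in k -> t \in k -> lin s t \is a mpolyOver 3 k.
  move=> ks kt; rewrite qualifE /=; apply/allP => _ /mapP[m _ ->] /=.
  rewrite mcoeffD !mcoeffZ !mcoeffX.
  have [<-|_] := eqVneq U_(0%R)%MM m; last first.
    by rewrite mulr0 add0r; case: eqP; rewrite ?mulr1 ?mulr0.
  rewrite mulr1 (_ : (_ == _) = false) ?mulr0 ?addr0 //.
  by apply/eqP => /mnmP/(_ 0); rewrite !mnm1E.
have wdegU (i : 'I_3) : wdeg U_(i)%MM = tnth [tuple 1; 3; 1]%N i.
  rewrite /wdeg (bigD1 i) //= mnm1E eqxx mul1n big1 ?addn0 // => j ji.
  by rewrite mnm1E eq_sym (negPf ji).
have lin_homog s t : lin s t \is [in K[3], 1.-homog for wdeg].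
  by apply: rpredD; apply: dhomogZ; rewrite dhomogX /= wdegU.
have at_nonvanish (Q : curve f) :
    nonvanishing (lin a b) (e *: 'X_1) (lin c d) Q.
  rewrite /nonvanishing !linE.
  by have /orP[->|->] := lin_neq0 (hcoord_neq0 (val Q)); rewrite ?orbT.
exists 1%N, (lin a b), (e *: 'X_1), (lin c d); split => //.
- split; try exact: lin_over.
  rewrite qualifE /=; apply/allP => _ /mapP[m _ ->]; rewrite mcoeffZ mcoeffX.
  by case: eqP; rewrite ?mulr1 ?mulr0.
- by split=> //; apply: dhomogZ; rewrite dhomogX /= wdegU.
move=> Q _; rewrite !linE alphaE /at_pt mevalZ mevalXU.
exact: represents_wlin (represents_hcoord _).
Qed.

End LinearMap.
End Weighted.

Section LinearMapExamples.
Variable K : fieldType.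
Implicit Types (a b c d e x y : K) (P : wpoint K).

Lemma wlin1 P : wlin 1 0 0 1 1 P = P.
Proof.
rewrite {2}(wpoint_of_represents (represents_hcoord P)) /wlin.
by rewrite !mul1r !mul0r addr0 add0r.
Qed.

Lemma wlin_affine a b c d e x y : c * x + d != 0 ->
  wlin a b c d e (Some x, y) =
    (Some ((a * x + b) / (c * x + d)), e * y / (c * x + d) ^+ 3).
Proof.
move=> L0; rewrite /wlin /wpoint_of /P1_of /hcoord !(tnth_nth 0) /= !mulr1.
by rewrite (negPf L0).
Qed.

(** A matrix of trace zero squares to the scalar a^2 + b c; the condition on
    [e] makes the middle coordinate scale by the cube of this scalar, as the
    weights require. *)
Lemma wlin_invol a b c e : a ^+ 2 + b * c != 0 -> e ^+ 2 = (a ^+ 2 + b * c) ^+ 3 ->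
  involutive (wlin a b c (- a) e).
Proof.
move=> r0 eE P.
have det0 : a * - a - b * c != 0 by rewrite mulrN -opprD oppr_eq0.
rewrite (wpoint_of_represents (represents_wlin e det0
  (represents_wlin e det0 (represents_hcoord P)))).
apply/esym/wpoint_of_represents; exists (a ^+ 2 + b * c) => //.
by split; rewrite -?eE; ring.
Qed.

End LinearMapExamples.

(** * Products of three quadratics as binary forms *)

Section Quadratic.
Variable K : fieldType.
Implicit Types (s u v w : {poly K}) (x z : K).

Definition hquad s x z := x ^+ 2 + s`_1 * x * z + s`_0 * z ^+ 2.

Lemma monic_quadraticE s : s \is monic -> size s = 3%N ->
  s = 'X^2 + s`_1 *: 'X + (s`_0)%:P.
Proof.
move=> /monicP; rewrite /lead_coef => + s3; rewrite s3 /= => s2.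
apply/polyP => -[|[|[|i]]]; rewrite !coefD coefZ coefXn coefX coefC /=.
- by rewrite mulr0 !add0r.
- by rewrite mulr1 add0r addr0.
- by rewrite s2 mulr0 !addr0.
by rewrite mulr0 !addr0 nth_default // s3.
Qed.

Lemma horner_monic_quadratic s x : s \is monic -> size s = 3%N ->
  s.[x] = hquad s x 1.
Proof.
move=> sm s3; rewrite /hquad expr1n !mulr1 {1}(monic_quadraticE sm s3).
by rewrite !hornerE.
Qed.

Lemma hform_horner (f : {poly K}) x z :
  (size f <= 7)%N -> z != 0 -> hform f x z = z ^+ 6 * f.[x / z].
Proof.
move=> f7 z0; rewrite (horner_coef_wide _ f7) mulr_sumr; apply: eq_bigr => i _.
have -> : z ^+ 6 = z ^+ i * z ^+ (6 - i) by rewrite -exprD subnKC // -ltnS.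
rewrite expr_div_n; have := expf_neq0 i z0; set zi := z ^+ i => zi0.
by field.
Qed.

(** Away from z = 0 this is the multiplicativity of evaluation at x / z; on
    z = 0 only the leading coefficients remain, and they are all 1. *)
Lemma hform_prod u v w x z :
  u \is monic -> v \is monic -> w \is monic ->
  size u = 3%N -> size v = 3%N -> size w = 3%N ->
  hform (u * v * w) x z = hquad u x z * hquad v x z * hquad w x z.
Proof.
move=> um vm wm u3 v3 w3.
have uvwm : u * v * w \is monic by rewrite !monicMr.
have uvw7 : size (u * v * w) = 7%N.
  by rewrite size_Mmonic ?size_Mmonic ?monic_neq0 // ?u3 ?v3 ?w3 // monicMr.
have [->|z0] := eqVneq z 0.
  have f6 : (u * v * w)`_6 = 1 by move/monicP: uvwm; rewrite /lead_coef uvw7.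
  rewrite /hform big_ord_recr /= big1 => [|i _].
    by rewrite f6 /hquad; ring.
  by rewrite [0 ^+ _]expr0n subn_eq0 leqNgt ltn_ord mulr0.
rewrite hform_horner ?uvw7 // !hornerM !horner_monic_quadratic // /hquad.
by field.
Qed.

End Quadratic.

(** * The pencil, the determinant and the resultant *)

Section PencilAlgebra.
Variable R : comNzRingType.

(** The hypothesis says that (s_0, s_1, 1) is in the kernel of (M2, -M1, M0),
    the linear form vanishing on the pencil.  The difference of the two sides
    is that hypothesis times M2 x^2 + 2 M1 x z + M0 z^2, the form whose zeros
    are the fixed points of the involution. *)
Lemma pencil_involution (M2 M1 M0 s1 s0 x z : R) :
  M0 - s1 * M1 + s0 * M2 = 0 ->
  let x' := - M1 * x + - M0 * z in
  let z' := M2 * x + M1 * z in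
  x' ^+ 2 + s1 * x' * z' + s0 * z' ^+ 2 =
    (M1 ^+ 2 - M2 * M0) * (x ^+ 2 + s1 * x * z + s0 * z ^+ 2).
Proof.
move=> E /=; rewrite -[RHS]addr0.
rewrite -(mul0r (M2 * x ^+ 2 + 2 * M1 * x * z + M0 * z ^+ 2)) -E.
by ring.
Qed.

(** Indexing the entries by natural numbers lets Laplace expansion be iterated
    by rewriting, without ordinals of varying bounds in the minors. *)
Definition det_nat n (g : nat -> nat -> R) :=
  \det (\matrix_(i < n, j < n) g i j).

Lemma det_nat_laplace n (g : nat -> nat -> R) :
  det_nat n.+1 g =
    \sum_(j < n.+1) (-1) ^+ j * g 0%N j
      * det_nat n (fun i k => g i.+1 (bump j k)).
Proof.
rewrite /det_nat (expand_det_row _ 0); apply: eq_bigr => j _.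
rewrite mxE /cofactor mulrA [_ * (-1) ^+ _]mulrC; congr (_ * \det _).
by apply/matrixP => i k; rewrite !mxE.
Qed.

Lemma det_nat0 (g : nat -> nat -> R) : det_nat 0 g = 1.
Proof. exact: det_mx00. Qed.

Lemma det_nat3 (g : nat -> nat -> R) :
  det_nat 3 g =
    g 0%N 0%N * (g 1%N 1%N * g 2%N 2%N - g 1%N 2%N * g 2%N 1%N)
    - g 0%N 1%N * (g 1%N 0%N * g 2%N 2%N - g 1%N 2%N * g 2%N 0%N)
    + g 0%N 2%N * (g 1%N 0%N * g 2%N 1%N - g 1%N 1%N * g 2%N 0%N).
Proof.
rewrite !(det_nat_laplace, big_ord_recl, big_ord0, det_nat0) /= /bump /=.
by rewrite !(addn0, add0n) /=; ring.
Qed.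

End PencilAlgebra.

Section Minors.
Variable F : finFieldType.
Implicit Types u v w : {poly F}.

Lemma frakdE u v w :
  frakd u v w = minor1 u v * (w`_1 - u`_1) - minor2 u v * (w`_0 - u`_0).
Proof.
pose g i j := nth 0 [:: (nth 0 [:: u; v; w] i)`_0; (nth 0 [:: u; v; w] i)`_1; 1] j.
transitivity (det_nat 3 g).
  congr (\det _); apply/matrixP => i j; rewrite !mxE /g.
  by rewrite (tnth_nth 0) /= (tnth_nth 0).
by rewrite det_nat3 /g /minor1 /minor2 /=; ring.
Qed.

Lemma resultant_minors u v : monic_quadratic u -> monic_quadratic v ->
  resultant u v = minor1 u v ^+ 2 - minor2 u v * minor0 u v.
Proof.
move=> /andP[/monicP um /eqP u3] /andP[/monicP vm /eqP v3].
move: um vm; rewrite /lead_coef u3 v3 /= => u2 v2.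
pose g i j := if (i < 2)%N then u`_(j - i) *+ (i <= j)%N
              else v`_(j - (i - 2)) *+ (i - 2 <= j)%N.
(* The Sylvester matrix has a size depending on [size u] and [size v], so the
   equality of the size with 4 is used on an arbitrary matrix. *)
have detE n (A : 'M[F]_n) : n = 4%N -> (forall i j, A i j = g i j) ->
    \det A = det_nat 4 g.
  move=> n4; subst n => AE; congr (\det _); apply/matrixP => i j.
  by rewrite mxE AE.
rewrite /resultant (detE _ _ _ _); last first.
- move=> i j; rewrite Sylvester_mxE /g.
  case: splitP => k ->; first by rewrite (_ : (k < 2)%N) // -[2%N]/(3.-1)%N -v3.
  by rewrite (_ : ((size v).-1 + k = k.+2)%N) ?v3 // !subSS subn0.
- by rewrite u3 v3.
have v_3 : v`_3 = 0 by rewrite nth_default ?v3.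
have u_3 : u`_3 = 0 by rewrite nth_default ?u3.
rewrite det_nat_laplace !big_ord_recl big_ord0 !det_nat3 /g /bump /=.
rewrite !subn0 ?subn1 ?subnn /= ?u2 ?v2 ?u_3 ?v_3 /minor0 /minor1 /minor2.
by ring.
Qed.

End Minors.

(** * Lifting points of the x-line *)

Section ClosedField.
Variables (K : closedFieldType) (f : {poly K}).

Lemma closed_sqrt (a : K) : exists y, y ^+ 2 = a.
Proof.
have /closed_rootP[y] : size ('X^2 - a%:P) != 1%N by rewrite size_XnsubC.
by rewrite rootE !hornerE subr_eq0 => /eqP; exists y.
Qed.

Lemma xline_surj (p : P1 K) : exists P : curve f, xline P = p.
Proof.
pose X := tnth (hcoord (p, 0 : K)) 0; pose Z := tnth (hcoord (p, 0 : K)) 2.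
have [y yE] := closed_sqrt (hform f X Z).
have Pf : on_curve f (p, y).
  rewrite (on_curve_represents _ (represents_hcoord _)).
  by case: p @X @Z yE => [x|] /=; rewrite /hcoord !(tnth_nth 0) /= => ->.
by exists (Sub (p, y) Pf).
Qed.

End ClosedField.

(** * The Frobenius map on points and fields of definition *)

Lemma card_pchar_pnat (F : finFieldType) (p : nat) :
  p \in [pchar F] -> p.-nat #|F|.
Proof.
by move=> pF; rewrite -cardsT; exact: abelem_pgroup (fin_ring_pchar_abelem pF).
Qed.

Lemma odd_card_neq0 (F : finFieldType) : odd #|F| -> 2 != 0 :> F.
Proof.
move=> oddF; apply/eqP => F2.
have /card_pchar_pnat/p_natP[k qE] : 2%N \in [pchar F] by rewrite inE F2 eqxx.
move: oddF (finNzRing_gt1 F); rewrite qE oddX orbF => /eqP ->.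
by rewrite expn0.
Qed.

Section Frobenius.
Variables (F : finFieldType) (K : fieldType) (phi : {rmorphism F -> K}).
Notation q := #|F|.

Lemma frobD : {morph (fun x : K => x ^+ q) : x y / x + y}.
Proof.
have [p p_pr pF] := finPcharP F.
move=> x y; apply: exprDn_pchar.
rewrite (eq_pnat _ (pcharf_eq (rmorph_pchar phi pF))).
exact: card_pchar_pnat.
Qed.

Lemma frob0 : (0 : K) ^+ q = 0.
Proof. by rewrite expr0n eqn0Ngt ltnW // finNzRing_gt1. Qed.

Lemma frob_sum (I : Type) (r : seq I) (P : pred I) (E : I -> K) :
  (\sum_(i <- r | P i) E i) ^+ q = \sum_(i <- r | P i) E i ^+ q.
Proof. exact: (big_morph _ frobD frob0). Qed.

Lemma frob_phi a : phi a ^+ q = phi a.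
Proof. by rewrite -rmorphXn expf_card. Qed.

Lemma frob_codom x : x \in codom phi -> x ^+ q = x.
Proof. by case/codomP => a ->; exact: frob_phi. Qed.

(** The elements of F already give all the roots of X^q - X in K. *)
Lemma frob_fixed x : x ^+ q = x -> x \in codom phi.
Proof.
move=> xq; have := congr1 (fun p => (map_poly phi p).[x]) (finField_genPoly F).
rewrite rmorphB /= map_polyXn map_polyX !hornerE xq subrr rmorph_prod horner_prod.
move=> /esym/eqP/prodf_eq0[a _].
by rewrite rmorphB /= map_polyX map_polyC !hornerE subr_eq0 => /eqP ->; apply: codom_f.
Qed.

Lemma meval_frob n (A : {mpoly K[n]}) (h : 'I_n -> K) :
  A \is a mpolyOver n (mem (codom phi)) ->
  A.@[h] ^+ q = A.@[fun i => h i ^+ q].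
Proof.
rewrite qualifE /= => /allP A_over; rewrite !mevalE frob_sum.
rewrite !big_seq; apply: eq_bigr => m mA.
rewrite exprMn (frob_codom (A_over _ (map_f _ mA))) -prodrXl; congr (_ * _).
by apply: eq_bigr => i _; rewrite -!exprM mulnC.
Qed.

Definition frob_pt (P : wpoint K) : wpoint K :=
  (omap (fun x => x ^+ q) P.1, P.2 ^+ q).

Lemma hcoord_frob P i : tnth (hcoord (frob_pt P)) i = tnth (hcoord P) i ^+ q.
Proof.
case: P i => -[x|] y [[|[|[|//]]] i3]; rewrite /hcoord !(tnth_nth 0) /= ?expr1n //.
by rewrite frob0.
Qed.

Lemma represents_frob a b d P :
  represents a b d P -> represents (a ^+ q) (b ^+ q) (d ^+ q) (frob_pt P).
Proof.
case=> l l0 [-> -> ->]; exists (l ^+ q); first by rewrite expf_neq0.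
by rewrite !hcoord_frob !exprMn -!exprM exprM.
Qed.

Variable g : {poly F}.
Local Notation f := (map_poly phi g).

Lemma hform_frob x z : hform f x z ^+ q = hform f (x ^+ q) (z ^+ q).
Proof.
rewrite frob_sum; apply: eq_bigr => i _.
by rewrite !exprMn coef_map frob_phi -!exprM ![(q * _)%N]mulnC.
Qed.

Lemma frob_on_curve P : on_curve f P -> on_curve f (frob_pt P).
Proof.
rewrite !(on_curve_represents _ (represents_hcoord _)) !hcoord_frob => /eqP E.
by rewrite -hform_frob -E -!exprM mulnC.
Qed.

Definition frob_curve (P : curve f) : curve f :=
  Sub (frob_pt (val P)) (frob_on_curve (valP P)).

(** Polynomials over F commute with the q-power map, so that a local
    representation of [alpha] at P is also one at the Frobenius image of P. *)
Lemma morphism_over_frob (alpha : curve f -> curve f) :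
  morphism_over (mem (codom phi)) alpha ->
  forall P, val (alpha (frob_curve P)) = frob_pt (val (alpha P)).
Proof.
move=> alpha_over P.
have [d [A [B [D [[Ak Bk Dk] _ nvP repr]]]]] := alpha_over P.
have atE (E : {mpoly K[3]}) : E \is a mpolyOver 3 (mem (codom phi)) ->
    at_pt E (frob_curve P) = at_pt E P ^+ q.
  move=> Ek; rewrite /at_pt meval_frob //; apply: meval_eq => i.
  exact: hcoord_frob.
have nvFP : nonvanishing A B D (frob_curve P).
  rewrite /nonvanishing !atE //.
  by case/or3P: nvP => h; rewrite (expf_neq0 q h) ?orbT.
rewrite (wpoint_of_represents (repr _ nvFP)) !atE //; apply/esym/wpoint_of_represents.
exact: represents_frob (repr _ nvP).
Qed.

End Frobenius.

(** * Affine maps fixing monic quadratics *)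

Section Stabiliser.
Variable F : finFieldType.
Implicit Types (s u v w : {poly F}) (a b : F).

Lemma aff_actE s a b : monic_quadratic s -> a != 0 ->
  aff_act (a, b) s =
    'X^2 + ((b *+ 2 + s`_1) / a) *: 'X + ((b ^+ 2 + s`_1 * b + s`_0) / a ^+ 2)%:P.
Proof.
case/andP=> sm /eqP s3 a0; rewrite /aff_act /=.
rewrite {1}(monic_quadraticE sm s3) !comp_polyD comp_polyZ comp_polyC comp_polyX.
rewrite comp_Xn_poly -!mul_polyC.
have aV : a%:P * a^-1%:P = 1 :> {poly F} by rewrite -polyCM divff.
rewrite -exprVn !(polyCM, polyCD, polyCMn, rmorphXn) /=.
set A := a%:P; set A' := a^-1%:P; rewrite -/A -/A' in aV.
transitivity ((A * A') ^+ 2 * 'X^2 +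
  (A * A') * ((b%:P *+ 2 + (s`_1)%:P) * A' * 'X) +
  (b%:P ^+ 2 + (s`_1)%:P * b%:P + (s`_0)%:P) * A' ^+ 2); first by ring.
by rewrite aV; ring.
Qed.

Lemma aff_fix_coef1 s a b : monic_quadratic s -> a != 0 ->
  aff_act (a, b) s = s -> b *+ 2 = s`_1 * (a - 1).
Proof.
move=> sq a0; rewrite aff_actE // => /(congr1 (fun p : {poly F} => p`_1)).
rewrite !coefD coefXn coefZ coefX coefC /= mulr1 add0r addr0 => fixE.
have {}fixE : b *+ 2 + s`_1 = s`_1 * a by rewrite -{2}fixE divfK.
by rewrite mulrBr mulr1 -fixE addrK.
Qed.

(** This reflection exchanges the two roots of [s]. *)
Lemma aff_fix_reflection s : monic_quadratic s ->
  aff_act (-1, - s`_1) s = s.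
Proof.
move=> sq; rewrite aff_actE ?oppr_eq0 ?oner_eq0 //.
case/andP: sq => sm /eqP s3; rewrite [RHS](monic_quadraticE sm s3).
by congr (_ + _ *: _ + _%:P); field; rewrite ?oppr_eq0 oner_eq0.
Qed.

(** If a = 1 then 2 b = 0, so b = 0 in odd characteristic; hence a nontrivial
    element has a != 1 and its equation 2 b = (a - 1) s_1 determines s_1. *)
Lemma aff_stab_nontrivialP u v w :
  odd #|F| ->
  monic_quadratic u -> monic_quadratic v -> monic_quadratic w ->
  aff_stab u v w <> [set (1, 0)] <-> u`_1 = v`_1 /\ v`_1 = w`_1.
Proof.
move=> /odd_card_neq0 F2 uq vq wq; split=> [stab_neq | [uv vw] stab_eq].
  have [/exists_inP[[a b]]|] := boolP [exists g in aff_stab u v w, g != (1, 0)].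
    rewrite inE /= => /and4P[a0 /eqP/(aff_fix_coef1 uq a0) eu].
    move=> /eqP/(aff_fix_coef1 vq a0) ev /eqP/(aff_fix_coef1 wq a0) ew ab_neq.
    have a1 : a - 1 != 0.
      apply: contraNneq ab_neq => a1; move: eu; rewrite a1 mulr0 -mulr_natr.
      move/eqP; rewrite mulf_eq0 (negPf F2) orbF => /eqP ->.
      by move/eqP: a1; rewrite subr_eq0 => /eqP ->.
    by split; apply: (mulIf a1); rewrite -?eu -?ev -?ew.
  rewrite negb_exists_in => /forall_inP stab1; case: stab_neq.
  apply/setP => g; rewrite [in RHS]inE; apply/idP/eqP => [gP|->].
    by apply/eqP; rewrite -[_ == _]negbK; apply: stab1.
  rewrite inE /= /aff_act /= oner_eq0 scale1r addr0 comp_polyXr.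
  by rewrite !expr1n invr1 !scale1r !comp_polyXr !eqxx.
have : (-1, - u`_1) \in aff_stab u v w.
  rewrite inE /= oppr_eq0 oner_eq0 aff_fix_reflection // eqxx /=.
  by rewrite uv {1}aff_fix_reflection // vw aff_fix_reflection ?eqxx.
rewrite stab_eq inE => /eqP[/eqP]; rewrite -subr_eq0 -opprD oppr_eq0.
by rewrite -[1 + 1]/(2 : F) (negPf F2).
Qed.

End Stabiliser.

(** * Involutions and Moebius maps *)

Section Involution.
Variables (T : Type) (g : T -> T).
Hypothesis gK : involutive g.

Lemma iter_involutive n : iter n g =1 iter (odd n) g.
Proof.
elim: n => [|n IHn] x //; rewrite iterS IHn [odd n.+1]/=.
by case: (odd n) => /=; rewrite ?gK.
Qed.

Lemma in_cycle_involutive g' :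
  in_cycle g g' -> exists b : bool, g' =1 iter b g.
Proof.
case=> n [g'E|[gg' g'g]]; exists (odd n) => x; first by rewrite g'E iter_involutive.
rewrite -{1}[x](_ : iter n g (iter (odd n) g x) = x) ?gg' //.
by rewrite iter_involutive; case: (odd n) => //=; rewrite gK.
Qed.

Lemma involution_isog_C2 : ~ g =1 id -> cycle_isog_C2 g.
Proof.
move=> g_neq; exists (fun i x => iter i g x); split=> [i j x|i j|g'].
- by case: i j => -[|[|//]] ? [[|[|//]] ?] //=; rewrite gK.
- case: i => -[|[|//]] i2; case: j => -[|[|//]] j2 /= ij; try exact: val_inj.
  by have /g_neq : g =1 id by move=> x; rewrite -ij.
split=> [/in_cycle_involutive[b g'E]|[i g'E]]; last by exists i; left.
by exists (inZp b) => x; rewrite g'E; case: (b).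
Qed.

End Involution.

Section Mobius.
Variable K : fieldType.
Implicit Types a b c d e : K.

Lemma wlin_mobius a b c d e (P : wpoint K) :
  (wlin a b c d e P).1 = mobius a b c d P.1.
Proof.
case: P => -[x|] y; rewrite /wlin /wpoint_of /hcoord !(tnth_nth 0) /=.
  by rewrite !mulr1.
by rewrite !mulr1 !mulr0 !addr0.
Qed.

Lemma mobius_inf a b c d : mobius a b c d None = None <-> c = 0.
Proof. by rewrite /= /P1_of; case: eqP. Qed.

Lemma mobius_affine a b d : a != 0 -> d != 0 -> affine_map (mobius a b 0 d).
Proof.
move=> a0 d0; exists (a / d), (b / d); split; first by rewrite mulf_neq0 ?invr_eq0.
case=> [x|] /=; rewrite /P1_of ?eqxx // mul0r add0r (negPf d0) mulrDl.
by rewrite mulrAC.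
Qed.

(** Fixing infinity forces c = 0; then 0 and 1 go to - b / a and - 1 - b / a,
    which cannot be 0 and 1 at once when 2 != 0. *)
Lemma mobius_traceless_neq_id a b c : 2 != 0 :> K ->
  a ^+ 2 + b * c != 0 -> ~ mobius a b c (- a) =1 id.
Proof.
move=> two det0 id_mob.
have c0 : c = 0 by apply/(mobius_inf a b c (- a))/id_mob.
have a0 : a != 0 by rewrite c0 mulr0 addr0 sqrf_eq0 in det0.
have := id_mob (Some 1); have := id_mob (Some 0).
rewrite /= c0 /P1_of !mul0r add0r oppr_eq0 (negPf a0) mulr0 add0r mulr1.
case=> /eqP; rewrite mulf_eq0 invr_eq0 oppr_eq0 (negPf a0) orbF => /eqP ->.
rewrite addr0 invrN mulrN divff // => -[/eqP].
by rewrite -subr_eq0 -opprD oppr_eq0 -[1 + 1]/(2 : K) (negPf two).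
Qed.

End Mobius.

(** * Square-free products and collinear triples *)

Section Quadratics.
Variable F : finFieldType.
Implicit Types u v w : {poly F}.

(** A common factor of u and v divides u v twice. *)
Lemma square_free_resultant u v w : square_free (u * v * w) ->
  resultant u v != 0.
Proof.
move=> sf; rewrite resultant_eq0; apply: contraL (dvdp_mulr w _) => [g1|].
  by apply: sf (gcdp u v) _; rewrite neq_ltn g1 orbT.
by rewrite expr2 dvdp_mul ?dvdp_gcdl ?dvdp_gcdr.
Qed.

Lemma square_free_neq u v w : size u = 3%N -> square_free (u * v * w) -> u != v.
Proof.
move=> u3 sf; apply: contraTneq (sf u _) => [<-|]; last by rewrite u3.
by rewrite negbK expr2 dvdp_mulr.
Qed.

(** When u_1 = v_1 the determinant reduces to (v_0 - u_0)(w_1 - u_1), whose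
    first factor is nonzero because u and v differ. *)
Lemma collinear_minor2 u v w : monic_quadratic u -> monic_quadratic v ->
  u != v -> frakd u v w = 0 -> u`_1 = v`_1 -> v`_1 = w`_1.
Proof.
move=> /andP[um /eqP u3] /andP[vm /eqP v3] uv; rewrite frakdE /minor2 => + uv1.
rewrite uv1 subrr mul0r subr0 => /eqP; rewrite mulf_eq0 !subr_eq0.
case/orP=> /eqP // uv0; case/eqP: uv.
by rewrite (monic_quadraticE um u3) (monic_quadraticE vm v3) uv1 uv0.
Qed.

Lemma frakd_rot u v w : frakd v w u = frakd u v w.
Proof. by rewrite !frakdE /minor1 /minor2; ring. Qed.

Lemma square_class1P (x : F) : x != 0 ->
  square_class x = square_class 1 <-> exists r, x = r ^+ 2.
Proof.
move=> x0; split=> [eq1|[r xE]].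
  have : x \in square_class x.
    by apply/imsetP; exists 1; rewrite ?inE ?oner_eq0 // expr1n mulr1.
  by rewrite eq1 => /imsetP[r _]; rewrite mul1r; exists r.
have r0 : r != 0 by rewrite xE sqrf_eq0 in x0.
apply/setP => y; apply/imsetP/imsetP => -[s]; rewrite inE => s0 ->.
  by exists (r * s); rewrite ?inE ?mulf_neq0 // mul1r xE exprMn.
exists (s / r); first by rewrite inE mulf_neq0 ?invr_eq0.
by rewrite mul1r xE; field.
Qed.

End Quadratics.

(** * The automorphism attached to a collinear triple *)

Section Pencil.
Variables (F : finFieldType) (K : fieldType) (phi : {rmorphism F -> K}).
Variables (u v w : {poly F}).
Hypotheses (uq : monic_quadratic u) (vq : monic_quadratic v).
Hypotheses (wq : monic_quadratic w) (uvw_col : frakd u v w = 0).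
Local Notation M2 := (phi (minor2 u v)).
Local Notation M1 := (phi (minor1 u v)).
Local Notation M0 := (phi (minor0 u v)).

Lemma phi_resultant : phi (resultant u v) = M1 ^+ 2 - M2 * M0.
Proof. by rewrite resultant_minors // rmorphB rmorphXn rmorphM. Qed.

(** Each of u, v, w contributes one factor R; for u and v membership in the
    pencil is an identity, for w it is the vanishing of the determinant. *)
Lemma hform_pencil x z :
  hform (map_poly phi (u * v * w)) (- M1 * x + - M0 * z) (M2 * x + M1 * z) =
  phi (resultant u v) ^+ 3 * hform (map_poly phi (u * v * w)) x z.
Proof.
have pencil s : monic_quadratic s ->
    minor0 u v - s`_1 * minor1 u v + s`_0 * minor2 u v = 0 ->
  [/\ map_poly phi s \is monic, size (map_poly phi s) = 3%N &
    hquad (map_poly phi s) (- M1 * x + - M0 * z) (M2 * x + M1 * z) =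
    phi (resultant u v) * hquad (map_poly phi s) x z].
  case/andP=> sm /eqP s3 sE; split; first by rewrite map_monic.
    by rewrite size_map_poly.
  rewrite /hquad !coef_map /= phi_resultant pencil_involution //.
  by rewrite -!rmorphM -rmorphB -rmorphD sE rmorph0.
have [|um u3 uE] := pencil u uq; first by rewrite /minor0 /minor1 /minor2; ring.
have [|vm v3 vE] := pencil v vq; first by rewrite /minor0 /minor1 /minor2; ring.
have [|wm w3 wE] := pencil w wq.
  transitivity (- frakd u v w); last by rewrite uvw_col oppr0.
  by rewrite frakdE /minor0 /minor1 /minor2; ring.
rewrite !rmorphM /= !hform_prod // uE vE wE; ring.
Qed.

End Pencil.

Theorem proposition8p4 (F : finFieldType) (K : closedFieldType)
    (phi : {rmorphism F -> K}) (phi_alg : integralRange phi)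
    (u v w : {poly F}) (c : K) :
  odd #|F| ->
  monic_quadratic u -> monic_quadratic v -> monic_quadratic w ->
  size (u * v * w) = 7%N -> square_free (u * v * w) ->
  frakd u v w = 0 ->
  c ^+ 2 = phi (resultant u v) ^+ 3 ->
  let f : {poly K} := map_poly phi (u * v * w) in
  let C := curve f in
  let M2 := phi (minor2 u v) in
  let M1 := phi (minor1 u v) in
  let M0 := phi (minor0 u v) in
  let iota : P1 K -> P1 K := mobius (- M1) (- M0) M2 M1 in
  exists tau : C -> C,
    [/\ (forall P, xline (tau P) = iota (xline P))
        /\ (forall (P : C) (x y : K),
              val P = (Some x, y) -> M2 * x + M1 != 0 ->
              val (tau P) = (Some ((- M1 * x - M0) / (M2 * x + M1)),
                             c * y / (M2 * x + M1) ^+ 3)),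
        [/\ automorphism tau, tau \o tau =1 id
          & ~ tau =1 @hyperelliptic K f],
        (forall g, in_cycle iota g -> in_reduced_aut f g)
        /\ cycle_isog_C2 iota,
        (morphism_over (mem (codom phi)) tau
           <-> splitting_class u v = square_class 1)
        /\ (splitting_class u v <> square_class 1 ->
            morphism_over [pred x : K | x ^+ (#|F| ^ 2) == x] tau)
      & [<-> affine_map iota;
             iota None = None;
             [\/ minor2 u v = 0, minor2 v w = 0 | minor2 w u = 0];
             [/\ minor2 u v = 0, minor2 v w = 0 & minor2 w u = 0];
             u`_1 = v`_1 /\ v`_1 = w`_1;
             aff_stab u v w <> [set (1, 0)]]].
Proof.
move=> oddF uq vq wq uvw7 sf col cE f C M2 M1 M0 iota.
have F2 := odd_card_neq0 oddF.
have K2 : 2 != 0 :> K by rewrite -(rmorph_nat phi) fmorph_eq0.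
have R0 : resultant u v != 0 := square_free_resultant sf.
have phiR := phi_resultant phi uq vq; rewrite -/M2 -/M1 -/M0 in phiR.
have phiR0 : phi (resultant u v) != 0 by rewrite fmorph_eq0.
have iotaE : iota = mobius (- M1) (- M0) M2 (- - M1) by rewrite opprK.
have phiRE : phi (resultant u v) = (- M1) ^+ 2 + - M0 * M2 by rewrite phiR; ring.
have det0 : (- M1) * M1 - (- M0) * M2 != 0.
  suff -> : - M1 * M1 - - M0 * M2 = - phi (resultant u v) by rewrite oppr_eq0.
  by rewrite phiR; ring.
pose t := wlin (- M1) (- M0) M2 M1 c.
have tK : involutive t.
  have := @wlin_invol _ (- M1) (- M0) M2 c; rewrite opprK -phiRE; exact.
have t_curve P : on_curve f P -> on_curve f (t P).
  by apply: wlin_on_curve => // x z; rewrite hform_pencil // cE.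
pose tau (P : C) : C := Sub (t (val P)) (t_curve _ (valP P)).
have tauE P : val (tau P) = t (val P) by [].
have tauK : involutive tau by move=> P; apply: val_inj; rewrite !tauE tK.
have xtau P : xline (tau P) = iota (xline P) by exact: wlin_mobius.
have iotaK : involutive iota.
  by move=> p; have [P <-] := xline_surj f p; rewrite -!xtau tauK.
have iota_neq : ~ iota =1 id.
  by rewrite iotaE; apply: mobius_traceless_neq_id => //; rewrite -phiRE.
have tau_over (k : {pred K}) : 0 \in k ->
    [/\ - M1 \in k, - M0 \in k, M2 \in k, M1 \in k & c \in k] ->
    morphism_over k tau.
  by move=> k0 kM; apply: (wlin_morphism_over det0 k0 kM).
have tau_aut : automorphism tau.
  by split; [exact: tau_over | exists tau; split => //; exact: tau_over].
have id_aut : automorphism (id : C -> C).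
  have id_over : morphism_over predT (id : C -> C).
    apply: (@wlin_morphism_over _ 1 0 0 1 1) => // [|P]; last by rewrite wlin1.
    by rewrite mulr1 mulr0 subr0 oner_eq0.
  by split=> //; exists id.
have phi_codom a : phi a \in codom phi by exact: codom_f.
have M_codom : [/\ - M1 \in codom phi, - M0 \in codom phi,
    M2 \in codom phi & M1 \in codom phi].
  by split; rewrite -?[- M1]rmorphN -?[- M0]rmorphN; exact: phi_codom.
exists tau; split.
- split=> // P x y PE L0; rewrite tauE PE; exact: wlin_affine.
- split=> // tau_hyp; apply: iota_neq => p.
  by have [P <-] := xline_surj f p; rewrite -xtau tau_hyp.
- split; last exact: involution_isog_C2.
  move=> g /(in_cycle_involutive iotaK)[b gE].
  exists (iter b tau); split; first by case: (b); [exact: tau_aut | exact: id_aut].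
  have tau_iter P : xline (iter b tau P) = g (xline P) by rewrite gE; case: (b).
  by move=> beta [] betaE P; rewrite betaE; exact: tau_iter.
- split; last first.
    move=> _; have [kM1' kM0 kM2 kM1] := M_codom.
    have kE x : x \in codom phi -> x ^+ (#|F| ^ 2) == x.
      by move=> /frob_codom xq; rewrite exprM !xq.
    have c2q : (c ^+ #|F|) ^+ 2 = c ^+ 2.
      by rewrite -exprM mulnC exprM cE -rmorphXn frob_phi.
    apply: tau_over; rewrite ?inE -?(rmorph0 phi); first exact: kE.
    split; try exact: kE.
    rewrite exprM; move/eqP: c2q; rewrite eqf_sqr => /orP[] /eqP cq.
      by rewrite !cq.
    by rewrite !cq exprNn -signr_odd oddF expr1 mulN1r cq opprK.
  rewrite /splitting_class square_class1P //; split=> [tau_k | [r rE]]; last first.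
    have [kM1' kM0 kM2 kM1] := M_codom.
    apply: tau_over; first by rewrite -(rmorph0 phi).
    split=> //; have /eqP : c ^+ 2 = phi (r ^+ 3) ^+ 2.
      by rewrite cE rE -!rmorphXn -!exprM mulnC.
    by rewrite eqf_sqr => /orP[] /eqP ->; rewrite -?rmorphN.
  (* A point P with y != 0 and with finite image: there c can be read off from
     the Y-coordinates of P and of its image. *)
  have [x] : exists x, ~~ root (f * (M2 *: 'X + M1%:P)) x.
    apply/closed_nonrootP; rewrite mulf_neq0 //.
      by rewrite map_poly_eq0 -size_poly_gt0 uvw7.
    apply: contraNneq phiR0 => L0; rewrite phiR.
    have /eqP : (M2 *: 'X + M1%:P)`_1 = 0 by rewrite L0 coef0.
    have /eqP : (M2 *: 'X + M1%:P)`_0 = 0 by rewrite L0 coef0.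
    rewrite !coefD !coefZ !coefX !coefC /= mulr1 mulr0 addr0 add0r.
    by move=> /eqP -> /eqP ->; rewrite expr0n mul0r subr0.
  rewrite rootE !hornerE mulf_eq0 negb_or => /andP[fx0 L0].
  have [P xP] := xline_surj f (Some x).
  case PE : (val P) xP => [X y] /= xP; rewrite /xline PE /= in xP; subst X.
  have y0 : y != 0.
    have := valP P; rewrite PE (on_curve_represents _ (represents_hcoord _)).
    rewrite /hcoord !(tnth_nth 0) /= hform_horner ?oner_eq0 ?size_map_poly ?uvw7 //.
    by rewrite expr1n mul1r divr1 => /eqP yE; rewrite -sqrf_eq0 yE.
  have Lq : M2 * x ^+ #|F| + M1 = (M2 * x + M1) ^+ #|F|.
    by rewrite (frobD phi) exprMn !frob_phi.
  have Lq0 : M2 * x ^+ #|F| + M1 != 0 by rewrite Lq expf_neq0.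
  have := morphism_over_frob tau_k P; rewrite !tauE /= PE /t.
  rewrite (wlin_affine _ _ _ _ L0) (wlin_affine _ _ _ _ Lq0) /frob_pt /=.
  case=> _; rewrite 2!exprMn exprVn exprAC -Lq.
  have L3 : (M2 * x ^+ #|F| + M1) ^- 3 != 0 by rewrite invr_eq0 expf_neq0.
  move/(mulIf L3)/(mulIf (expf_neq0 #|F| y0))/esym/(frob_fixed phi)/codomP => -[c' c'E].
  exists (c' / resultant u v); apply: (fmorph_inj phi).
  rewrite rmorphXn rmorphM fmorphV -c'E exprMn cE; field; exact: phiR0.
have u3 : size u = 3%N by case/andP: uq => _ /eqP.
have v3 : size v = 3%N by case/andP: vq => _ /eqP.
have w3 : size w = 3%N by case/andP: wq => _ /eqP.
(* The rotated hypotheses let each of the three pairs play the part of (u, v). *)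
have sf' : square_free (v * w * u) by rewrite mulrC mulrA.
have sf'' : square_free (w * u * v) by rewrite mulrC mulrA.
have col' : frakd v w u = 0 by rewrite frakd_rot.
have col'' : frakd w u v = 0 by rewrite frakd_rot.
tfae.
- by case=> a [b [_ iotaE']]; rewrite iotaE'.
- move=> /(mobius_inf (- M1) (- M0) M2 M1) M20; apply: Or31; apply: (fmorph_inj phi).
  by rewrite rmorph0.
- have one_to_all : u`_1 = v`_1 -> v`_1 = w`_1 ->
      [/\ minor2 u v = 0, minor2 v w = 0 & minor2 w u = 0].
    by rewrite /minor2 => -> ->; rewrite subrr.
  case=> /subr0_eq/esym e.
  + exact: one_to_all e (collinear_minor2 uq vq (square_free_neq u3 sf) col e).
  + have e' := collinear_minor2 vq wq (square_free_neq v3 sf') col' e.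
    by apply: one_to_all => //; rewrite -e' e.
  + have e' := collinear_minor2 wq uq (square_free_neq w3 sf'') col'' e.
    by apply: one_to_all => //; rewrite -e' -e.
- by rewrite /minor2; case=> /subr0_eq -> /subr0_eq -> _.
- by move/(aff_stab_nontrivialP oddF uq vq wq).
move/(aff_stab_nontrivialP oddF uq vq wq) => [uv1 _].
have M20 : M2 = 0 by rewrite /M2 /minor2 uv1 subrr rmorph0.
have M1_0 : M1 != 0.
  by apply: contraNneq phiR0 => M1_0; rewrite phiR M1_0 M20 mul0r subr0 expr0n.
by rewrite /iota M20; apply: mobius_affine; rewrite ?oppr_eq0.
Qed.
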